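(* Let $R$ be a connected reduced order. Suppose that $A$ and $B$ are stark subrings of $R$ and that $G$ and $H$ are subgroups of the unit group $R^*$ such that $A[G]=B[H]=R$. Then $A[H]=B[G]=R$.
   Context: All rings have a unit element. An order is a commutative ring whose additive group is isomorphic to $\mathbb{Z}^n$ for some $n\in\mathbb{Z}_{\geq 0}$. A commutative ring is reduced if it has no non-zero nilpotent elements, and connected if it has exactly two idempotents (i.e. it is non-zero and $0,1$ are its only idempotents). A commutative ring is stark if there do not exist a ring $A$ and a non-trivial group $G$ such that it is isomorphic to the group ring $A[G]$. For a commutative ring $R$, a subring $A\subset R$ and a subgroup $G\subset R^*$, one writes $A[G]=R$ if the natural ring homomorphism from the group ring $A[G]$ to $R$ is an isomorphism. *)

(* Defs.v *)
From HB Require Import structures.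
From mathcomp Require Import all_boot all_order all_algebra.
From mathcomp Require Import finmap.
Set Implicit Arguments. Unset Strict Implicit. Unset Printing Implicit Defensive.
Import Order.TTheory GRing.Theory Num.Theory.
Local Open Scope ring_scope.

Definition is_order (R : comPzRingType) : Prop :=
  exists (n : nat) (f : 'rV[int]_n -> R),
    {morph f : x y / x + y} /\ bijective f.

Definition reduced (R : comPzRingType) : Prop :=
  forall (x : R) (n : nat), x ^+ n = 0 -> x = 0.

Definition connected (R : comPzRingType) : Prop :=
  (0 : R) != 1 /\ forall e : R, e * e = e -> e = 0 \/ e = 1.

Definition subgroup_of_units (R : comPzRingType) (G : {pred R}) : Prop :=
  [/\ 1 \in G,
      (forall x y, x \in G -> y \in G -> x * y \in G) &
      (forall x, x \in G -> exists2 y, y \in G & x * y = 1)].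

(* Elements of the group ring A[I] are finitely supported functions I -> A;
   given phi : A -> S and psi : I -> S, the natural map A[I] -> S sends
   f to  sum_i phi (f i) * psi i. *)
Definition gr_map (A : comPzRingType) (S : comPzRingType) (I : choiceType)
  (phi : A -> S) (psi : I -> S) (f : {fsfun I -> A with 0}) : S :=
  \sum_(i <- finsupp f) phi (f i) * psi i.

Definition gr_bij (A : comPzRingType) (S : comPzRingType) (I : choiceType)
  (phi : A -> S) (psi : I -> S) (P : {pred I}) : Prop :=
  (forall s : S, exists f : {fsfun I -> A with 0},
       {subset finsupp f <= P} /\ gr_map phi psi f = s) /\
  (forall f1 f2 : {fsfun I -> A with 0},
       {subset finsupp f1 <= P} -> {subset finsupp f2 <= P} ->
       gr_map phi psi f1 = gr_map phi psi f2 -> f1 = f2).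

(* R is isomorphic to the group ring A'[G'] (G' an abelian group, written
   additively): there are a ring morphism phi : A' -> R and a group morphism
   psi : G' -> R^* such that the induced ring morphism A'[G'] -> R is
   bijective. *)
Definition iso_group_ring (R : comPzRingType) (A' : comPzRingType)
  (G' : zmodType) : Prop :=
  exists (phi : {rmorphism A' -> R}) (psi : G' -> R),
    [/\ psi 0 = 1, {morph psi : x y / x + y >-> x * y} &
        gr_bij phi psi predT].

Definition stark (R : comPzRingType) : Prop :=
  ~ exists (A' : comPzRingType) (G' : zmodType),
      (exists g : G', g != 0) /\ iso_group_ring R A' G'.

(* Internal group ring: for a subring A of R (given by an injective ring
   morphism iA : A -> R) and a subgroup G of R^*, A[G] = R. *)
Definition group_ring_eq (R : comPzRingType) (A : comPzRingType)
  (iA : A -> R) (G : {pred R}) : Prop :=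
  gr_bij iA (fun x : R => x) G.

(* Main.v *)
(* Embed R into C^n through its n ring homomorphisms to algC, which gives R a
   positive definite hermitian form with a positive minimum.  Twisting embeddings
   by characters of G permutes them, so the decomposition R = (+)_g A g is
   orthogonal, and likewise R = (+)_h B h.  Any two orthogonal decompositions of
   such a lattice have a common refinement, so R is graded by G x H.  As R is
   connected, 1 is not a sum of two nonzero orthogonal vectors (AM-GM), hence
   neither is any unit of finite order: each g in G is homogeneous for the grading
   by H, and conversely.  This yields homomorphisms phi : G -> H and
   psi : H -> G.  A nontrivial kernel of psi would, by a Fitting argument applied to
   h |-> h / phi (psi h), exhibit A as a nontrivial group ring.  So phi and psi are
   injective, hence bijective; as h / psi h is a unit of A, A[G] = R gives
   A[H] = R, and symmetrically B[G] = R. *)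
Require Import Defs.
From HB Require Import structures.
From mathcomp Require Import all_boot all_order all_algebra all_field.
From mathcomp Require Import finmap ring boolp.
Import Order.TTheory GRing.Theory Num.Theory.
Set Implicit Arguments. Unset Strict Implicit. Unset Printing Implicit Defensive.
Local Open Scope ring_scope.

(** * Complex embeddings of a reduced order *)

Lemma rmorphism_ext (R S : pzRingType) (f : R -> S) :
  {morph f : x y / x + y} -> {morph f : x y / x * y} -> f 1 = 1 ->
  exists g : {rmorphism R -> S}, g =1 f.
Proof.
move=> fD fM f1.
have f0 : f 0 = 0 by apply: (addIr (f 0)); rewrite -fD !add0r.
have fB : zmod_morphism f.
  by move=> x y; apply: (addIr (f y)); rewrite -fD !subrK.
pose addm := GRing.isZmodMorphism.Build _ _ f fB.
pose mulm := GRing.isMonoidMorphism.Build _ _ f (conj f1 fM).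
pose g : {rmorphism R -> S} := HB.pack f addm mulm.
by exists g.
Qed.

Section Embeddings.

Variables (R : comPzRingType) (m : nat) (f : 'rV[int]_m.+1 -> R).
Variable c : R -> 'rV[int]_m.+1.
Hypotheses (fD : {morph f : x y / x + y}) (fK : cancel f c) (cK : cancel c f).
Hypothesis Rred : reduced R.

Local Notation n := m.+1.

Lemma coordD : {morph c : x y / x + y}.
Proof. by move=> x y; rewrite -{1}(cK x) -{1}(cK y) -fD fK. Qed.

Lemma coordB : {morph c : x y / x - y}.
Proof. by move=> x y; apply: (addIr (c y)); rewrite -coordD !subrK. Qed.

Lemma coord0 : c 0 = 0.
Proof. by apply: (addIr (c 0)); rewrite -coordD !add0r. Qed.

Definition ord_basis (i : 'I_n) : R := f (delta_mx 0 i).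
Local Notation e := ord_basis.

Lemma coord_basis i : c (e i) = delta_mx 0 i.
Proof. exact: fK. Qed.

Lemma coordMz x (k : int) : c (x *~ k) = k *: c x.
Proof.
have cMn p : c (x *+ p) = c x *+ p.
  by elim: p => [|p IH]; rewrite ?coord0 // !mulrS coordD IH.
case: k => p; first by rewrite cMn -scaler_nat natz.
by rewrite NegzE mulrNz -[LHS]addr0 -sub0r coordB coord0 cMn addr0 sub0r
  scaleNr -scaler_nat natz.
Qed.

Lemma coord_sum (I : Type) (r : seq I) (F : I -> R) :
  c (\sum_(i <- r) F i) = \sum_(i <- r) c (F i).
Proof. exact: (big_morph c coordD coord0). Qed.

Lemma basis_decomp x : x = \sum_i e i *~ c x 0 i.
Proof.
apply: (can_inj cK); rewrite coord_sum {1}[c x]row_sum_delta.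
by apply: eq_bigr => i _; rewrite coordMz coord_basis.
Qed.

(** * The regular representation over the integers and its simultaneous diagonalization *)

Definition mulmat (x : R) : 'M[int]_n := \matrix_i c (e i * x).
Local Notation M := mulmat.

Lemma row_mulmat i x : row i (M x) = c (e i * x).
Proof. exact: rowK. Qed.

Lemma coordM y x : c (y * x) = c y *m M x.
Proof.
rewrite {1}(basis_decomp y) mulr_suml coord_sum mulmx_sum_row.
by apply: eq_bigr => i _; rewrite mulrzAl coordMz row_mulmat.
Qed.

Lemma mulmatB : {morph M : x y / x - y}.
Proof.
by move=> x y; apply/row_matrixP=> i; rewrite linearB /= !row_mulmat mulrBr coordB.
Qed.

Lemma mulmatM x y : M (x * y) = M x *m M y.
Proof.
by apply/row_matrixP=> i; rewrite row_mul !row_mulmat mulrA -coordM.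
Qed.

Lemma mulmat1 : M 1 = 1%:M.
Proof. by apply/row_matrixP=> i; rewrite row_mulmat mulr1 coord_basis row1. Qed.

Lemma mulmat_eq0 x : M x = 0 -> x = 0.
Proof.
move=> Mx0; apply: (can_inj cK).
by rewrite -[x]mul1r coordM Mx0 mulmx0 coord0.
Qed.

Lemma mulmat0 : M 0 = 0.
Proof. by rewrite -(subrr 0) mulmatB subrr. Qed.

Lemma mulmatD : {morph M : x y / x + y}.
Proof.
move=> x y; rewrite -[y in LHS]opprK mulmatB -sub0r mulmatB mulmat0.
by rewrite sub0r opprK.
Qed.

Lemma mulmatX x k : M (x ^+ k) = M x ^+ k.
Proof. by elim: k => [|k IH]; rewrite ?mulmat1 // !exprS mulmatM IH. Qed.

Lemma mulmatMz x (k : int) : M (x *~ k) = k *: M x.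
Proof.
by apply/row_matrixP=> i; rewrite linearZ /= !row_mulmat mulrzAr coordMz.
Qed.

(** Integer polynomials in [M x] stay in the image of [R], where reducedness can be applied. *)
Lemma horner_mulmat x (p : {poly int}) : exists r, horner_mx (M x) p = M r.
Proof.
elim/poly_ind: p => [|p k [r IH]]; first by exists 0; rewrite rmorph0 mulmat0.
exists (r * x + 1 *~ k).
rewrite rmorphD rmorphM /= horner_mx_X horner_mx_C IH mulmatD mulmatM mulmatMz.
by rewrite mulmat1 scalemx1.
Qed.

Local Notation toQ := (map_mx (intr : int -> rat)).
Local Notation toC := (map_mx (intr : int -> algC)).

(** After clearing denominators, [p] evaluates to a rational multiple of some [M r]. The hypothesis
    then says [r ^+ 2 = 0], and [R] is reduced. *)
Lemma horner_mulmat_rat_sqr x (p : {poly rat}) :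
  horner_mx (toQ (M x)) (p * p) = 0 -> horner_mx (toQ (M x)) p = 0.
Proof.
have [q [a a0 ->]] := rat_poly_scale p.
rewrite -scalerAl -scalerAr scalerA -rmorphM !linearZ /= -!map_horner_mx.
have ai0 : a%:~R^-1 != 0 :> rat by rewrite invr_eq0 intr_eq0.
move/eqP; rewrite scaler_eq0 mulf_eq0 (negPf ai0) /= => /eqP Eqq.
have [r Er] := horner_mulmat x q.
suff -> : horner_mx (M x) q = 0 by rewrite map_mx0 scaler0.
rewrite Er; suff -> : r = 0 by rewrite mulmat0.
apply: (@Rred r 2); apply: mulmat_eq0; rewrite mulmatX -Er.
apply/matrixP=> i j; apply: (@intr_inj rat).
by move/matrixP/(_ i j): Eqq; rewrite mxE rmorphM -expr2 => ->; rewrite !mxE.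
Qed.

(* If the minimal polynomial were divisible by a square g^2, with g of
   positive degree, its quotient by g would have a nilpotent, hence zero, value
   at M x, against minimality. *)
Lemma mulmat_diagonalizable x : diagonalizable (toC (M x)).
Proof.
pose p := mxminpoly (toQ (M x)).
have p0 : p != 0 by rewrite monic_neq0 ?mxminpoly_monic.
have p_sep : separable_poly p.
  apply/separable_polyP; split=> [u v uvp|u _ su]; last first.
    (* In characteristic 0 a nonconstant factor has nonzero derivative: its top coefficient is a
       positive multiple of the leading coefficient of [u]. *)
    apply/eqP => du0; have := lead_coef_eq0 u; rewrite -size_poly_eq0 lead_coefE.
  case: (size u) su => [|[|k]] //= _; have /eqP := coef_deriv u k.
  by rewrite du0 coef0 eq_sym mulrn_eq0 => /eqP ->; rewrite eqxx.
  rewrite -[coprimep _ _]negbK; apply/negP => ncop.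
  pose g := gcdp u v.
  have ggp : g * g %| p.
    by apply: dvdp_trans uvp; rewrite dvdp_mul ?dvdp_gcdl ?dvdp_gcdr.
  case/dvdpP: ggp => q pE.
  have /eqP hp : horner_mx (toQ (M x)) (q * g * (q * g)) == 0.
    by rewrite -dvd_mxminpoly -/p mulrACA -mulrA -pE dvdp_mull.
  have /eqP := horner_mulmat_rat_sqr hp.
  rewrite -dvd_mxminpoly -/p => /dvdp_leq.
  have qg0 : q * g != 0.
    by apply: contraNneq p0 => qg0; rewrite pE mulrA qg0 mul0r.
  have g0 : g != 0 by apply: contraNneq qg0 => ->; rewrite mulr0.
  move/(_ qg0); rewrite pE mulrA size_mul //.
  have sqg : (0 < size (q * g)%R)%N by rewrite lt0n size_poly_eq0.
  move: ncop; rewrite -/g /coprimep -/g => ncop.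
  have : (1 < size g)%N.
    by rewrite ltn_neqAle eq_sym ncop lt0n size_poly_eq0.
  by case: (size g) => // -[//|k] _; rewrite !addnS /= leqNgt ltnS leq_addr.
have [rs rsE] := closed_field_poly_normal (map_poly (ratr : rat -> algC) p).
rewrite (monicP _) ?map_monic ?mxminpoly_monic // scale1r in rsE.
apply/diagonalizableP; exists rs.
  by rewrite -separable_prod_XsubC -rsE separable_map.
rewrite -rsE -mxminpoly_map dvd_mxminpoly.
suff -> : toC (M x) = map_mx (ratr : rat -> algC) (toQ (M x)).
  by rewrite mx_root_minpoly.
by apply/matrixP=> i j; rewrite !mxE ratr_int.
Qed.

Lemma mulmat_comm x y : comm_mx (toC (M x)) (toC (M y)).
Proof. by rewrite /comm_mx -!map_mxM -!mulmatM mulrC. Qed.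

Lemma coord_toC_eq (k : nat) (W : 'M[algC]_(n, k)) :
  (forall x, toC (c x) *m W = 0) -> W = 0.
Proof.
move=> W0; apply/row_matrixP=> i; rewrite row0 rowE.
by rewrite -(map_delta_mx (intr : int -> algC)) -coord_basis W0.
Qed.

(* A simultaneous eigenbasis W of the multiplication matrices gives linear
   forms x |-> (c x W)_j with c (x y) W = c x W D_y, so each of them is a
   nonzero multiple of the homomorphism y |-> D_y(j, j). *)
Lemma mulmat_codiagonalization :
  exists (W V : 'M[algC]_n) (s : 'I_n -> R -> algC),
    [/\ V *m W = 1%:M, W *m V = 1%:M &
      forall x, toC (M x) *m W = W *m diag_mx (\row_j s j x)].
Proof.
pose As := [seq toC (M (e i)) | i <- enum 'I_n].
have : codiagonalizable As.
  apply/codiagonalizableP; split.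
    by move=> _ _ /mapP[i _ ->] /mapP[j _ ->]; apply: mulmat_comm.
  by move=> _ /mapP[i _ ->]; apply: mulmat_diagonalizable.
case=> V Vu /allP /= dA.
have dM x : is_diag_mx (V *m toC (M x) *m invmx V).
  have -> : toC (M x) = \sum_i (c x 0 i)%:~R *: toC (M (e i)).
    rewrite [in LHS](basis_decomp x) (big_morph M mulmatD mulmat0).
    rewrite raddf_sum /=; by apply: eq_bigr => i _; rewrite mulmatMz map_mxZ.
  apply/is_diag_mxP => i j ij; rewrite mulmx_sumr mulmx_suml summxE big1 // => l _.
  have /is_diag_mxP/(_ i j ij) : is_diag_mx (V *m toC (M (e l)) *m invmx V).
    have eAs : toC (M (e l)) \in As by apply: map_f; rewrite mem_enum.
    by have := dA _ eAs; rewrite /= /similar_to conjumx.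
  by move=> E; rewrite -scalemxAr -scalemxAl mxE E mulr0.
exists (invmx V), V, (fun j x => (V *m toC (M x) *m invmx V) j j).
split; [exact: mulmxV | exact: mulVmx|move=> x].
have /is_diag_mxP dMx := dM x.
rewrite -[LHS]mul1mx -(mulVmx Vu) -!mulmxA; congr (_ *m _).
apply/matrixP => i j; rewrite [RHS]mxE [X in X *+ _]mxE mulmxA.
case: eqP => [->|/eqP ij]; last by rewrite mulr0n dMx.
by rewrite mulr1n.
Qed.

Lemma trace_norm_int (W V : 'M[algC]_n) (d : 'rV_n) x :
  V *m W = 1%:M -> W *m V = 1%:M -> toC (M x) *m W = W *m diag_mx d ->
  \sum_j d 0 j = (\tr (M x))%:~R /\ \prod_j d 0 j = (\det (M x))%:~R.
Proof.
move=> VW WV E.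
have dE : diag_mx d = V *m (toC (M x) *m W) by rewrite E mulmxA VW mul1mx.
split; first by rewrite -mxtrace_diag dE mxtrace_mulC -mulmxA WV mulmx1 trace_map_mx.
by rewrite -det_diag dE !det_mulmx mulrCA -det_mulmx VW det1 mulr1 det_map_mx.
Qed.

(** Modulo 2 the matrix is the scalar -1, so its determinant is odd. Applied to [M x], this bounds
    the norm of 2x - 1 below by 1. *)
Lemma odd_det (A : 'M[int]_n) : \det (A + A - 1%:M) != 0.
Proof.
apply/eqP => /(congr1 (intr : int -> 'F_2)); rewrite -det_map_mx.
have -> : map_mx (intr : int -> 'F_2) (A + A - 1%:M) = (-1)%:M.
  apply/matrixP => i j; rewrite !mxE !(intrD, intrN) -mulr2n.
  rewrite -mulr_natl pchar_Zp // mul0r add0r.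
  by case: eqP; rewrite ?mulr0n ?mulr0z ?oppr0.
by rewrite det_scalar rmorph0 => /eqP; rewrite expf_eq0 oppr_eq0 oner_eq0 andbF.
Qed.

Lemma complex_embeddings :
  exists s : 'I_n -> {rmorphism R -> algC},
    [/\ forall d, (forall x, \sum_j d j * s j x = 0) -> forall j, d j = 0,
      forall t : {rmorphism R -> algC}, exists j, s j =1 t,
      forall x, (forall j, s j x = 0) -> x = 0,
      forall x, \sum_j s j x \is a Num.int
    & forall x, 1 <= `|\prod_j s j (x + x - 1)|].
Proof.
have [W [V [s [VW WV sW]]]] := mulmat_codiagonalization.
have W_inj (k : nat) (Y Z : 'M_(n, k)) : W *m Y = W *m Z -> Y = Z.
  by move=> E; rewrite -[Y]mul1mx -VW -mulmxA E mulmxA VW mul1mx.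
have sD j : {morph s j : x y / x + y}.
  move=> x y; have /W_inj/matrixP/(_ j j) : W *m diag_mx (\row_i s i (x + y)) =
      W *m (diag_mx (\row_i s i x) + diag_mx (\row_i s i y)).
    by rewrite mulmxDr -!sW -mulmxDl -map_mxD mulmatD.
  by rewrite !mxE eqxx !mulr1n.
have sM j : {morph s j : x y / x * y}.
  move=> x y; have /W_inj/matrixP/(_ j j) : W *m diag_mx (\row_i s i (x * y)) =
      W *m (diag_mx (\row_i s i x) *m diag_mx (\row_i s i y)).
    by rewrite mulmxA -!sW -mulmxA -sW mulmxA -map_mxM mulmatM.
  by rewrite mulmx_diag !mxE eqxx !mulr1n.
have s1 j : s j 1 = 1.
  have /W_inj/matrixP/(_ j j) : W *m diag_mx (\row_i s i 1) = W *m 1%:M.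
    by rewrite -sW mulmat1 map_mx1 mul1mx mulmx1.
  by rewrite !mxE eqxx !mulr1n.
have [g gE] := fin_all_exists (fun j => rmorphism_ext (sD j) (sM j) (s1 j)).
(* The j-th eigenform takes the value [k 0 j] at 1, so it equals [k 0 j] times [g j]. If [k 0 j]
   were zero, the j-th column of [W] would vanish. *)
have [k kE] : exists k : 'rV_n, k = toC (c 1) *m W by eexists.
have cW x j : (toC (c x) *m W) 0 j = k 0 j * g j x.
  rewrite -[x in LHS]mul1r coordM map_mxM -mulmxA sW mulmxA -kE.
  by rewrite mul_mx_diag !mxE gE.
have k0 j : k 0 j != 0.
  apply/eqP => kj0.
  suff /W_inj/matrixP/(_ j 0) : W *m (delta_mx j 0 : 'cV_n) = W *m 0.
    by rewrite !mxE !eqxx => /eqP; rewrite oner_eq0.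
  rewrite mulmx0.
  apply: coord_toC_eq => x; rewrite mulmxA -colE; apply/matrixP => a b.
  by rewrite !ord1 mxE cW kj0 mul0r mxE.
have indep d : (forall x, \sum_j d j * g j x = 0) -> forall j, d j = 0.
  move=> d0 j; pose D : 'cV_n := \col_j (d j / k 0 j).
  suff : W *m D = W *m 0.
    by move/W_inj/matrixP/(_ j 0); rewrite !mxE => /eqP; rewrite 
      mulf_eq0 invr_eq0 (negPf (k0 j)) orbF => /eqP.
  rewrite mulmx0; apply: coord_toC_eq => x; rewrite mulmxA.
  apply/matrixP => a b; rewrite !ord1 [LHS]mxE [RHS]mxE -[RHS](d0 x).
  apply: eq_bigr => i _.
  by rewrite cW [D i 0]mxE mulrC mulrA divfK.
exists g; split => //.
(* Expand [t] as a combination of the [g j]. Comparing t(yx) with t(y)t(x), independence kills each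
   coefficient times [g j y - t y]; since t(1) = 1, some coefficient is nonzero, and its [g j]
   equals [t]. *)
- move=> t; pose T : 'cV[algC]_n := \col_i t (e i).
  have tE x : t x = \sum_j (V *m T) j 0 * k 0 j * g j x.
    have -> : t x = (toC (c x) *m T) 0 0.
      rewrite [in LHS](basis_decomp x) rmorph_sum mxE; apply: eq_bigr => i _.
      by rewrite rmorphMz !mxE mulrzl.
    rewrite -[T in LHS]mul1mx -WV -mulmxA mulmxA mxE; apply: eq_bigr => j _.
    by rewrite cW mulrC mulrA.
  have tj j y : (V *m T) j 0 * k 0 j * (g j y - t y) = 0.
    apply: (indep (fun j => (V *m T) j 0 * k 0 j * (g j y - t y))) => x.
    transitivity (\sum_i (V *m T) i 0 * k 0 i * g i (y * x) -
                  t y * \sum_i (V *m T) i 0 * k 0 i * g i x).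
      by rewrite mulr_sumr -sumrB; apply: eq_bigr => i _; rewrite rmorphM; ring.
    by rewrite -!tE rmorphM subrr.
  have [|] := boolP [exists j, (V *m T) j 0 * k 0 j != 0].
    case/existsP => j /negPf j0; exists j => y.
    by have /eqP := tj j y; rewrite mulf_eq0 j0 subr_eq0 => /eqP.
  rewrite negb_exists => /forallP T0; have := oner_neq0 algC.
  rewrite -(rmorph1 t) tE big1 ?eqxx // => j _.
  by have := T0 j; rewrite negbK => /eqP ->; rewrite mul0r.
- move=> x x0; apply: mulmat_eq0; apply/matrixP => i j; apply: (@intr_inj algC).
  suff /matrixP/(_ i j) : toC (M x) = 0 by rewrite !mxE.
  rewrite -[LHS]mulmx1 -WV mulmxA sW.
  suff -> : \row_j s j x = 0 by rewrite linear0 mulmx0 mul0mx.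
  by apply/rowP => l; rewrite !mxE -gE x0.
- move=> x; have [tr _] := trace_norm_int VW WV (sW x).
  rewrite (_ : \sum_j _ = (\tr (M x))%:~R) ?intr_int //.
  by rewrite -tr; apply: eq_bigr => j _; rewrite gE mxE.
- move=> x; have [_ nm] := trace_norm_int VW WV (sW (x + x - 1)).
  rewrite (_ : \prod_j _ = (\det (M (x + x - 1)))%:~R).
    apply: norm_intr_ge1; first exact: intr_int.
    by rewrite intr_eq0 mulmatB mulmatD mulmat1 odd_det.
  by rewrite -nm; apply: eq_bigr => j _; rewrite gE mxE.
Qed.
End Embeddings.

(* The trace pairing takes integer values on a Z-basis, so an element all of
   whose conjugates are small pairs to zero with everything. *)
Lemma order_embeddings (R : comPzRingType) :
  is_order R -> reduced R -> (0 : R) != 1 ->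
  exists (n : nat) (s : 'I_n -> {rmorphism R -> algC}),
    [/\ forall j k, s j =1 s k -> j = k,
      forall t : {rmorphism R -> algC}, exists j, s j =1 t,
      forall x, (forall j, s j x = 0) -> x = 0,
      exists2 eps : algC, 0 < eps &
        forall x, (forall j, `|s j x| < eps) -> x = 0
    & forall x, 1 <= `|\prod_j s j (x + x - 1)|].
Proof.
move=> [[|m] [f [fD [c fK cK]]]] Rred R01.
  by case/eqP: R01; rewrite -(cK 0) -(cK 1) [c 0]thinmx0 [c 1]thinmx0.
have [s [indep compl inj tr nm]] := complex_embeddings fD fK cK Rred.
exists m.+1, s; split => //.
- move=> j k jk; apply/eqP; apply: contraT => njk.
  have : (j == j)%:R - (j == k)%:R = 0 :> algC.
    apply: (indep (fun i => (i == j)%:R - (i == k)%:R)) => x.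
    under eq_bigr => i _ do rewrite mulrBl.
    have pick l : \sum_i (i == l)%:R * s i x = s l x.
      by rewrite (bigD1 l) //= eqxx mul1r big1 ?addr0 // => i /negPf->; rewrite mul0r.
    by rewrite sumrB !pick jk subrr.
  by rewrite eqxx (negPf njk) subr0 => /eqP; rewrite oner_eq0.
pose C : algC := \sum_i \sum_j `|s j (ord_basis f i)|.
have C0 : 0 <= C by do 2!apply: sumr_ge0 => ? _.
have C1 : 0 < C + 1 by apply: ltr_wpDl.
(* With this bound every trace of x times a basis element is at most C/(C+1) < 1 in absolute value,
   hence zero, being an integer. *)
exists (C + 1)^-1; first by rewrite invr_gt0.
move=> x xeps; apply: inj; apply: indep => y.
have tr0 i : \sum_j s j x * s j (ord_basis f i) = 0.
  have Ei : \sum_j s j x * s j (ord_basis f i) =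
            \sum_j s j (x * ord_basis f i).
    by apply: eq_bigr => j _; rewrite rmorphM.
  apply/eqP; apply: contraT; rewrite Ei => /(norm_intr_ge1 (tr _)).
  rewrite -Ei => /le_lt_trans - /(_ 1); rewrite ltxx; apply.
  apply: le_lt_trans (ler_norm_sum _ _ _) _.
  apply: (@le_lt_trans _ _ ((C + 1)^-1 * C)); last first.
    by rewrite mulrC ltr_pdivrMr // mul1r ltrDl.
  apply: (@le_trans _ _ ((C + 1)^-1 * \sum_j `|s j (ord_basis f i)|)); last first.
    rewrite ler_wpM2l ?invr_ge0 ?(ltW C1) // /C [leRHS](bigD1 i) //= lerDl.
    by do 2!apply: sumr_ge0 => ? _.
  rewrite mulr_sumr; apply: ler_sum => j _.
  by rewrite normrM ler_wpM2r // ltW.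
rewrite [in LHS](basis_decomp fD fK cK y).
under eq_bigr => j _ do rewrite rmorph_sum mulr_sumr.
rewrite exchange_big big1 //= => i _.
under eq_bigr => j _ do rewrite rmorphMz mulrzAr -mulrzl.
by rewrite -mulr_sumr tr0 mulr0.
Qed.

(** * The hermitian lattice *)

Section HermitianLattice.

Variables (R : comPzRingType) (n : nat) (s : 'I_n -> {rmorphism R -> algC}).

Definition herm (x y : R) : algC := \sum_j s j x * (s j y)^*.
Definition sqn (x : R) : algC := \sum_j `|s j x| ^+ 2.
(** Orthogonality of [p x] and [x - p x] is recorded as Pythagoras' identity, the form in which the
    induction on norms uses it. *)
Definition orth_proj (p : R -> R) : Prop :=
  {morph p : x y / x + y} /\ forall x, sqn x = sqn (p x) + sqn (x - p x).

Lemma sqn_ge0 x : 0 <= sqn x.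
Proof. by apply: sumr_ge0 => j _; rewrite exprn_ge0. Qed.

Lemma sqn1 : sqn 1 = n%:R.
Proof.
rewrite /sqn (eq_bigr (fun=> 1)) ?sumr_const ?card_ord // => j _.
by rewrite rmorph1 normr1 expr1n.
Qed.

Lemma sqnD x y : herm x y = 0 -> sqn (x + y) = sqn x + sqn y.
Proof.
move=> xy0.
have yx0 : herm y x = 0.
  rewrite -[LHS]conjCK -[RHS]conjC0 -[X in _ = X^*]xy0; congr _^*.
  rewrite rmorph_sum; apply: eq_bigr => j _ /=.
  by rewrite rmorphM /= conjCK mulrC.
rewrite -[RHS]addr0 -xy0 -[RHS]addr0 -yx0 -!big_split; apply: eq_bigr => j _ /=.
by rewrite !normCK !rmorphD /=; ring.
Qed.

Lemma sqn_parallelogram x y : sqn (x - y) + sqn (x + y) = (sqn x + sqn y) *+ 2.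
Proof.
rewrite -big_split -big_split -sumrMnl; apply: eq_bigr => j _ /=.
by rewrite !normCK !(rmorphD, rmorphB) /=; ring.
Qed.

Lemma sqn_unitary u x : (forall j, `|s j u| = 1) -> sqn (x * u) = sqn x.
Proof.
by move=> u1; apply: eq_bigr => j _; rewrite rmorphM normrM u1 mulr1.
Qed.

Lemma herm_suml (I : eqType) (r : seq I) (F : I -> R) y :
  {in r, forall i, herm (F i) y = 0} -> herm (\sum_(i <- r) F i) y = 0.
Proof.
move=> F0; rewrite /herm.
under eq_bigr => j _ do rewrite rmorph_sum mulr_suml.
rewrite exchange_big /= big_seq big1 // => i ir; exact: F0.
Qed.

Variable eps : algC.
Hypothesis eps_gt0 : 0 < eps.
Hypothesis eps_small : forall x, (forall j, `|s j x| < eps) -> x = 0.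
Hypothesis norm_ge1 : forall x, 1 <= `|\prod_j s j (x + x - 1)|.

Lemma sqn_ge x : x != 0 -> eps ^+ 2 <= sqn x.
Proof.
move=> x0; have [/forallP /eps_small xE|] := boolP [forall j, `|s j x| < eps].
  by rewrite xE eqxx in x0.
rewrite negb_forall => /existsP[j].
rewrite -real_leNgt ?realE ?normr_ge0 ?(ltW eps_gt0) // => epsj.
rewrite /sqn (bigD1 j) //= -[leLHS]addr0 lerD ?sumr_ge0 // => [|i _].
  by rewrite lerXn2r ?nnegrE ?(ltW eps_gt0).
by rewrite exprn_ge0.
Qed.

(* Induction on the norm: x is either a sum of two shorter vectors or fixed or
   killed by each of p and q. *)
Lemma orth_proj_comm p q :
  orth_proj p -> orth_proj q -> forall x, p (q x) = q (p x).
Proof.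
move=> [pD pQ] [qD qQ] x.
have e2 : 0 < eps ^+ 2 by rewrite exprn_gt0.
have [N] : exists N : nat, sqn x < N%:R * eps ^+ 2.
  exists (Num.Def.archi_bound (sqn x / eps ^+ 2)).
  rewrite -ltr_pdivrMr //; apply: archi_boundP.
  by rewrite divr_ge0 ?sqn_ge0 ?ltW.
elim: N x => [|N IH] x; first by rewrite mul0r => /lt_geF; rewrite sqn_ge0.
rewrite -[N.+1]addn1 natrD mulrDl mul1r => xN.
(* Each nonzero summand takes up at least [eps ^+ 2] of the norm, so the other one satisfies the
   bound with [N] in place of [N.+1]. *)
have shorter y z : sqn x = sqn y + sqn z -> y != 0 -> z != 0 ->
    sqn y < N%:R * eps ^+ 2 /\ sqn z < N%:R * eps ^+ 2.
  move=> E y0 z0; rewrite E in xN.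
  split; rewrite -(ltrD2r (eps ^+ 2)); apply: le_lt_trans xN.
    by rewrite lerD2l sqn_ge.
  by rewrite addrC lerD2r sqn_ge.
have f0 r : {morph r : x y / x + y} -> r (0 : R) = 0 :> R.
  by move=> rD; apply: (addIr (r 0)); rewrite -rD !add0r.
have step r : orth_proj r -> r x != 0 -> x - r x != 0 -> p (q x) = q (p x).
  have xE : x = r x + (x - r x) by rewrite addrC subrK.
  move=> [_ /(_ x)]; move: (r x) (x - r x) xE => y z xE E y0 z0.
  have [yN zN] := shorter _ _ E y0 z0.
  by rewrite xE !(pD, qD) !IH.
have [p0|np0] := eqVneq (p x) 0; last first.
  have [/eqP|npx] := eqVneq (x - p x) 0; last exact: step np0 npx.
  rewrite subr_eq0 => /eqP px; rewrite -px.
  have [q0|nq0] := eqVneq (q x) 0; first by rewrite q0 f0.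
  have [/eqP|nqx] := eqVneq (x - q x) 0; last first.
    by rewrite [in RHS]px; exact: step nq0 nqx.
  by rewrite subr_eq0 => /eqP qx; rewrite -qx -px.
rewrite p0 f0 //.
have [q0|nq0] := eqVneq (q x) 0; first by rewrite q0 f0.
have [/eqP|nqx] := eqVneq (x - q x) 0; last first.
  by rewrite (step q) // p0 f0.
by rewrite subr_eq0 => /eqP qx; rewrite -qx.
Qed.

(* z = 2x - 1 has odd, hence nonzero, norm and sqn z = n, so the AM-GM inequality
   forces all |s j z| = 1; then z^2 = 1 + 4 (x^2 - x) shows that all conjugates of
   x^2 - x are at most 1/2 in absolute value. *)
Lemma orth_split1_idem x :
  reduced R -> sqn 1 = sqn x + sqn (1 - x) -> x * x = x.
Proof.
move=> Rred E1.
pose z := x + x - 1.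
have Ez : sqn z = n%:R.
  (* The parallelogram law for x and 1 - x reads sqn z + sqn 1 = 2 sqn 1, so z is as long as 1. *)
  have := sqn_parallelogram x (1 - x); rewrite -E1 [x + (1 - x)]addrC subrK.
  rewrite (_ : x - (1 - x) = z); last by rewrite /z opprB addrA.
  by rewrite sqn1 mulr2n => /addIr.
have z1 j : `|s j z| = 1.
  have n0 : (0 < n)%N by apply: leq_ltn_trans (ltn_ord j).
  have pos : {in 'I_n, forall j, 0 <= `|s j z| ^+ 2} by move=> ? _; rewrite exprn_ge0.
  have := leif_AGM pos.
  rewrite card_ord (eq_bigl predT) // [X in X / _](eq_bigl predT) //.
  rewrite -/(sqn z) Ez divff ?pnatr_eq0 -?lt0n // expr1n => -[le1 eq1].
  have ge1 : 1 <= \prod_j `|s j z| ^+ 2.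
    rewrite prodrXl -normr_prod -[leLHS](expr1n _ 2) lerXn2r ?nnegrE //.
    exact: norm_ge1.
  move: eq1; rewrite eq_le le1 ge1 => /esym/forallP eqs.
  have eqj i : `|s i z| ^+ 2 = `|s j z| ^+ 2.
    by have /forallP/(_ j)/eqP := eqs i.
  have : n%:R * `|s j z| ^+ 2 = n%:R.
    rewrite -[RHS]Ez /sqn; under [RHS]eq_bigr => i _ do rewrite eqj.
    by rewrite sumr_const card_ord mulr_natl.
  move/(canRL (mulKf _)); rewrite pnatr_eq0 -lt0n n0 => /(_ isT).
  rewrite mulVf ?pnatr_eq0 -?lt0n // => /eqP.
  by rewrite sqrp_eq1 // => /eqP.
pose w := x * x - x.
have w2 j : `|s j w| <= 2^-1.
  have Ew : s j w *+ 4 = s j z ^+ 2 - 1.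
    by rewrite /w /z !(rmorphB, rmorphD, rmorphM, rmorph1) /=; ring.
  have : `|s j w *+ 4| <= 2^-1 *+ 4.
    rewrite (_ : 2^-1 *+ 4 = 2) ?Ew; last by field.
    apply: le_trans (ler_normB _ _) _.
    by rewrite normrX z1 normr1 expr1n.
  by rewrite normrMn ler_pMn2r.
(* A high power of [w] has all conjugates below [eps], hence is zero; reducedness then gives
   [w = 0]. *)
have [N Neps] : exists N : nat, 2^-1 ^+ N < eps.
  exists (Num.Def.archi_bound eps^-1).
  rewrite exprVn invf_plt ?posrE ?exprn_gt0 //.
  apply: lt_le_trans (archi_boundP _) _; first by rewrite invr_ge0 ltW.
  by rewrite -natrX ler_nat ltnW // ltn_expl.
have wN : w ^+ N = 0.
  apply: eps_small => j; rewrite rmorphXn normrX; apply: le_lt_trans Neps.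
  by rewrite lerXn2r ?nnegrE ?invr_ge0.
by apply/eqP; rewrite -subr_eq0 -/w (Rred _ _ wN).
Qed.

(** Multiplication by [v] is an isometry, so it carries the orthogonal splitting of [u] into [p u]
    and [u - p u] to one of 1. Thus [p u * v] is idempotent, and connectedness leaves only 0 and
    1. *)
Lemma orth_proj_unitary p u v :
  reduced R -> connected R -> orth_proj p -> u * v = 1 ->
  (forall j, `|s j u| = 1) -> p u = 0 \/ p u = u.
Proof.
move=> Rred [_ Rconn] [_ pQ] uv u1.
have v1 j : `|s j v| = 1.
  have := congr1 (fun x => `|s j x|) uv.
  by rewrite rmorphM rmorph1 normrM u1 mul1r normr1.
have vE : p u = p u * v * u by rewrite -mulrA [v * u]mulrC uv mulr1.
have /Rconn : p u * v * (p u * v) = p u * v.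
  apply: orth_split1_idem => //; rewrite -[in 1 - _]uv -mulrBl.
  by rewrite !(sqn_unitary _ v1) -pQ -(sqn_unitary u v1) uv.
by case=> E; [left|right]; rewrite vE E ?mul0r ?mul1r.
Qed.

End HermitianLattice.

(** * Finitely supported functions *)

Section FiniteSupport.

Variables (A S : comPzRingType) (I : choiceType).
Variables (phi : {rmorphism A -> S}) (psi : I -> S).

Lemma gr_map_seq (t : seq I) (f : {fsfun I -> A with 0}) :
  uniq t -> {subset finsupp f <= t} ->
  gr_map phi psi f = \sum_(i <- t) phi (f i) * psi i.
Proof.
move=> ut ft; rewrite /gr_map [RHS](bigID (mem (finsupp f))) /=.
rewrite [X in _ + X]big1 ?addr0; last first.
  by move=> i; rewrite mem_finsupp negbK => /eqP ->; rewrite rmorph0 mul0r.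
rewrite -[RHS]big_filter; apply: perm_big; apply: uniq_perm.
- exact: fset_uniq.
- exact: filter_uniq.
by move=> i; rewrite mem_filter andb_idr // => /ft.
Qed.

Lemma fsfun_of_seq (t : seq I) (a : I -> A) :
  exists2 f : {fsfun I -> A with 0},
    {subset finsupp f <= t} & {in t, f =1 a}.
Proof.
pose f : {fsfun I -> A with 0} := [fsfun i in [fset x in t]%fset => a i].
exists f => [i|i it]; rewrite ?mem_finsupp fsfunE in_fset /=; last by rewrite it.
by case: ifP => //; rewrite eqxx.
Qed.

(** Once the index set is enumerated by a list, finitely supported functions can be traded for
    arbitrary functions compared on that list. *)
Lemma gr_bijP (P : {pred I}) (t : seq I) : uniq t -> t =i P ->
  gr_bij phi psi P <->
  (forall x, exists a : I -> A, x = \sum_(i <- t) phi (a i) * psi i) /\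
  (forall a b : I -> A,
     \sum_(i <- t) phi (a i) * psi i = \sum_(i <- t) phi (b i) * psi i ->
     {in t, a =1 b}).
Proof.
move=> ut tP; split=> -[sur inj]; split.
- move=> x; have [f [fP <-]] := sur x; exists f.
  by apply: gr_map_seq => // i /fP; rewrite tP.
- move=> a b ab.
  have [f ft fa] := fsfun_of_seq t a; have [g gt gb] := fsfun_of_seq t b.
  have fg : f = g.
    apply: inj => [i /ft|i /gt|]; rewrite ?tP //.
    rewrite !(gr_map_seq ut) //.
    transitivity (\sum_(i <- t) phi (a i) * psi i); last rewrite ab.
      by apply: eq_big_seq => i it; rewrite fa.
    by apply: eq_big_seq => i it; rewrite gb.
  by move=> i it; rewrite -fa // fg gb.
- move=> x; have [a ->] := sur x; have [f ft fa] := fsfun_of_seq t a.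
  exists f; split=> [i /ft|]; first by rewrite tP.
  by rewrite (gr_map_seq ut) //; apply: eq_big_seq => i it; rewrite fa.
move=> f g fP gP.
have ft : {subset finsupp f <= t} by move=> i /fP; rewrite tP.
have gt : {subset finsupp g <= t} by move=> i /gP; rewrite tP.
rewrite !(gr_map_seq ut) // => /inj fg; apply/fsfunP => i.
have [/fg //|nit] := boolP (i \in t).
rewrite !fsfun_dflt //; first by apply: contra nit => /gt.
by apply: contra nit => /ft.
Qed.

End FiniteSupport.

(* The supports of the elements of a Z-basis contain the support {g} of 1 g. *)
Lemma group_ring_finite (R A : comPzRingType) (iA : {rmorphism A -> R})
    (G : {pred R}) :
  is_order R -> (0 : R) != 1 -> group_ring_eq iA G ->
  exists2 t : seq R, uniq t & t =i G.
Proof.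
move=> [[|m] [f [fD [c fK cK]]]] R01 [sur inj].
  by case/eqP: R01; rewrite -(cK 0) -(cK 1) [c 0]thinmx0 [c 1]thinmx0.
have [F FE] := fin_all_exists (fun i : 'I_m.+1 => sur (ord_basis f i)).
pose T := undup (flatten [seq (finsupp (F i) : seq R) | i <- enum 'I_m.+1]).
have FT i : {subset finsupp (F i) <= T}.
  move=> g gF; rewrite mem_undup; apply/flattenP.
  by exists (finsupp (F i) : seq R) => //; apply: map_f; rewrite mem_enum.
exists [seq g <- T | g \in G]; first by rewrite filter_uniq ?undup_uniq.
move=> g; rewrite mem_filter andb_idr // => gG.
(* [d] is the group ring element 1 g, and [h] combines the [F i] with the coordinates of [g]. Both
   map to [g], so they agree and [g] lies in the support of [h]. *)
have [d dg d1] := fsfun_of_seq [:: g] (fun=> 1 : A).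
have [h hT hE] := fsfun_of_seq T (fun x => \sum_i F i x *~ c g 0 i).
have dG : {subset finsupp d <= G} by move=> x /dg; rewrite inE => /eqP ->.
have hG : {subset finsupp h <= G}.
  move=> x xh; apply: contraT => nxG.
  have : h x = 0.
    rewrite hE ?hT // big1 // => i _; have [FG _] := FE i.
    rewrite fsfun_dflt ?mul0rz //; apply: contra nxG => /FG //.
  by move/eqP; rewrite -[_ == _]negbK -mem_finsupp xh.
have dh : d = h.
  apply: inj => //; rewrite (gr_map_seq _ _ _ dg) // big_seq1 d1 ?inE //.
  rewrite rmorph1 mul1r (gr_map_seq _ _ (undup_uniq _) hT).
  rewrite {1}(basis_decomp fD fK cK g).
  under [RHS]eq_big_seq => x xT do rewrite hE // rmorph_sum mulr_suml.
  rewrite exchange_big /=; apply: eq_bigr => i _; have [_ <-] := FE i.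
  rewrite (gr_map_seq _ _ (undup_uniq _) (FT i)) -mulrzl mulr_sumr.
  apply: eq_bigr => x _.
  by rewrite rmorphMz !mulrzAl mul1r.
apply: hT; rewrite -dh mem_finsupp d1 ?inE //; apply: contraNneq R01 => A10.
by rewrite -(rmorph1 iA) A10 rmorph0.
Qed.

(** * Finite groups of units *)

(** With m the size of [t], every orbit repeats by step m: it enters a cycle after i < m steps and
    is then invariant under m - i further ones. The factorial of m is a multiple of each such m - i
    and at least each such i. *)
Lemma iter_idempotent (T : eqType) (t : seq T) (f : T -> T) :
  {in t, forall x, f x \in t} ->
  exists2 N, (0 < N)%N & {in t, forall x, iter N f (iter N f x) = iter N f x}.
Proof.
move=> ft; set m := size t.
exists m`! => [|x xt]; first exact: fact_gt0.
have : looping f x m.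
  apply: contraT; rewrite -looping_uniq => /uniq_leq_size => /(_ t).
  rewrite size_traject ltnn; apply=> _ /trajectP[i _ ->].
  by elim: i => //= i; apply: ft.
case/trajectP => i im E.
have period k q : (i <= k)%N -> iter (q * (m - i) + k) f x = iter k f x.
  move=> ik; elim: q => // q IH; rewrite -[RHS]IH mulSn -addnA.
  have /subnKC <- : (i <= q * (m - i) + k)%N by rewrite (leq_trans ik) ?leq_addl.
  by rewrite addnA subnK ?(ltnW im) // ![(_ + (_ - _))%N]addnC !iterD E.
rewrite -iterD; have /dvdnP[q Eq] : (m - i %| m`!)%N.
  by rewrite dvdn_fact // subn_gt0 im leq_subr.
rewrite {1}Eq period // (leq_trans (ltnW im)) //.
by rewrite dvdn_leq ?fact_gt0 // dvdn_fact // leqnn andbT (leq_ltn_trans _ im).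
Qed.

Definition finite_group (R : comPzRingType) (t : seq R) : Prop :=
  [/\ uniq t, 1 \in t, {in t &, forall x y, x * y \in t} &
      {in t, forall x, exists2 y, y \in t & x * y = 1}].

Section FiniteGroup.

Variables (R : comPzRingType) (t : seq R).
Hypothesis tG : finite_group t.

Lemma finite_groupX x k : x \in t -> x ^+ k \in t.
Proof.
case: tG => _ t1 tM _ xt.
by elim: k => [|k IH]; rewrite ?expr0 // exprS tM.
Qed.

(** Iterating (x, y) |-> (x, x y) multiplies the second entry by powers of x. An idempotent iterate
    gives x^N x^N = x^N, and x^N can be cancelled. *)
Lemma finite_group_expn : exists2 N, (0 < N)%N & {in t, forall x, x ^+ N = 1}.
Proof.
case: tG => _ t1 tM tV.
pose f (z : R * R) := (z.1, z.1 * z.2).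
have iterf k x y : iter k f (x, y) = (x, x ^+ k * y).
  by elim: k => [|k IH]; rewrite ?mul1r //= IH /f /= exprS mulrA.
have [z /allpairsP[[x y] [xt yt ->]]|N N0 HN] :=
    @iter_idempotent _ [seq (x, y) | x <- t, y <- t] f.
  by apply/allpairsP; exists (x, x * y); rewrite tM.
exists N => // x xt; have [y yt xy] := tV _ (finite_groupX N xt).
have /HN : (x, 1) \in [seq (x, y) | x <- t, y <- t].
  by apply/allpairsP; exists (x, 1).
rewrite !iterf mulr1 => -[E].
by rewrite -[LHS]mulr1 -xy mulrA E.
Qed.

End FiniteGroup.

(** * Orthogonality of the components of a group ring *)

(* [p g] is the projection of R = (+)_(g in t) A g onto its summand A g. *)
Record group_grading (R A : comPzRingType) (iA : A -> R) (t : seq R)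
    (p : R -> R -> R) : Prop := GroupGrading {
  comp_add : forall g, {morph p g : x y / x + y};
  comp_sum : forall x, x = \sum_(g <- t) p g x;
  comp_mem : forall g x, exists a, p g x = iA a * g;
  comp_hom : forall a g h, g \in t ->
    p h (iA a * g) = if h == g then iA a * g else 0
}.

Lemma group_ring_grading (R A : comPzRingType) (iA : {rmorphism A -> R})
    (G : {pred R}) (t : seq R) :
  uniq t -> t =i G -> group_ring_eq iA G ->
  exists p, group_grading iA t p.
Proof.
move=> ut tG /(gr_bijP _ _ ut tG)[/choice[F FE] inj].
(* Components outside [t] are set to zero, so that [comp_hom] and [comp_mem] hold for every
   index. *)
exists (fun h x => if h \in t then iA (F x h) * h else 0); split.
- move=> h x y; case: ifP => [ht|_]; last by rewrite addr0.
  rewrite -mulrDl -rmorphD; congr (iA _ * _).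
  apply: (inj (F (x + y)) (fun h => F x h + F y h)) => //.
  rewrite -FE {1}(FE x) {1}(FE y) -big_split; apply: eq_bigr => g _ /=.
  by rewrite rmorphD mulrDl.
- by move=> x; rewrite {1}(FE x); apply: eq_big_seq => g ->.
- move=> h x; case: ifP => _; first by exists (F x h).
  by exists 0; rewrite rmorph0 mul0r.
move=> a g h gt.
have E : {in t, F (iA a * g) =1 (fun h => if h == g then a else 0)}.
  apply: inj; rewrite -FE (big_rem g) //= eqxx big_seq big1 ?addr0 // => k.
  by rewrite mem_rem_uniq // inE => /andP[/negPf -> _]; rewrite rmorph0 mul0r.
case: ifP => [ht|]; last by case: eqP => // -> /negP; rewrite gt.
by rewrite E //; case: eqP => [->|] //; rewrite rmorph0 mul0r.
Qed.

Section GradingTheory.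

Variables (R A : comPzRingType) (iA : {rmorphism A -> R}) (t : seq R).
Variable p : R -> R -> R.
Hypotheses (tG : finite_group t) (pG : group_grading iA t p).

Lemma comp0 g : p g 0 = 0.
Proof. by apply: (addIr (p g 0)); rewrite -(comp_add pG) !add0r. Qed.

Lemma comp_big g (I : Type) (r : seq I) (F : I -> R) :
  p g (\sum_(i <- r) F i) = \sum_(i <- r) p g (F i).
Proof. exact: (big_morph _ (comp_add pG g) (comp0 g)). Qed.

Lemma unit_norm1 (f : {rmorphism R -> algC}) g : g \in t -> `|f g| = 1.
Proof.
move=> gt; have [N N0 /(_ g gt) gN] := finite_group_expn tG.
apply/eqP; rewrite -(pexpr_eq1 N0) // -normrX -rmorphXn gN rmorph1.
by rewrite normr1.
Qed.

Variables (n : nat) (s : 'I_n -> {rmorphism R -> algC}).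
Hypothesis s_uniq : forall j k, s j =1 s k -> j = k.
Hypothesis s_complete : forall f : {rmorphism R -> algC}, exists j, s j =1 f.
Hypothesis s_inj : forall x, (forall j, s j x = 0) -> x = 0.

(* Every character of G that comes from an embedding s_i can be used to twist
   s_j into the homomorphism a g |-> s_j (a g) s_i g. *)
Lemma twisted_embedding i j :
  exists k, forall a g, g \in t -> s k (iA a * g) = s j (iA a * g) * s i g.
Proof.
have [_ t1 tM _] := tG; have ut : uniq t by case: tG.
pose f x : algC := \sum_(g <- t) s j (p g x) * s i g.
have fhom a g : g \in t -> f (iA a * g) = s j (iA a * g) * s i g.
  move=> gt; rewrite /f (big_rem g) //= (comp_hom pG) // eqxx.
  rewrite big_seq big1 ?addr0 // => h; rewrite mem_rem_uniq // inE => /andP[hg _].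
  by rewrite (comp_hom pG) // (negPf hg) rmorph0 mul0r.
have fD : {morph f : x y / x + y}.
  move=> x y; rewrite -big_split; apply: eq_bigr => g _ /=.
  by rewrite (comp_add pG) rmorphD mulrDl.
have f0 : f 0 = 0 by apply: (addIr (f 0)); rewrite -fD !add0r.
have f1 : f 1 = 1.
  by rewrite -[in f 1](mulr1 1) -{1}(rmorph1 iA) fhom // mulr1 rmorph1 !rmorph1 mulr1.
have fM : {morph f : x y / x * y}.
  move=> x y; rewrite [in LHS](comp_sum pG x) mulr_suml (big_morph f fD f0).
  rewrite mulr_suml; apply: eq_big_seq => g gt.
  rewrite [in LHS](comp_sum pG y) mulr_sumr (big_morph f fD f0).
  rewrite mulr_sumr; apply: eq_big_seq => h ht.
  have [a ->] := comp_mem pG g x; have [b ->] := comp_mem pG h y.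
  rewrite (_ : _ * _ = iA (a * b) * (g * h)); last by rewrite rmorphM mulrACA.
  by rewrite fhom ?tM // !rmorphM; ring.
have [f' f'E] := rmorphism_ext fD fM f1.
have [k kE] := s_complete f'.
by exists k => a g gt; rewrite kE f'E fhom.
Qed.

(** Some embedding [s i] separates [g] and [h]. Twisting by it permutes the embeddings, so the
    pairing equals itself times [s i g * (s i h)^*]; this factor is not 1, both values having
    modulus 1, so the pairing is zero. *)
Lemma comp_herm0 a b g h : g \in t -> h \in t -> g != h ->
  herm s (iA a * g) (iA b * h) = 0.
Proof.
move=> gt ht gh.
have [i igh] : exists i, s i g != s i h.
  apply/existsP; apply: contraT; rewrite negb_exists => /forallP sgh.
  case/eqP: gh; apply/eqP; rewrite -subr_eq0; apply/eqP/s_inj => i.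
  by have := sgh i; rewrite negbK rmorphB => /eqP ->; rewrite subrr.
have [k kE] := fin_all_exists (twisted_embedding i).
have nz x : x \in t -> s i x != 0.
  by move=> xt; rewrite -normr_eq0 unit_norm1 ?oner_eq0.
(* The twist multiplies each homogeneous component by a nonzero number, so it can be undone. *)
have k_inj : injective k.
  move=> j l jl; apply: s_uniq => x; rewrite (comp_sum pG x) !rmorph_sum.
  apply: eq_big_seq => y yt; have [c ->] := comp_mem pG y x.
  by apply: (mulIf (nz y yt)); rewrite -!kE // jl.
have E : herm s (iA a * g) (iA b * h) =
         herm s (iA a * g) (iA b * h) * (s i g * (s i h)^*).
  rewrite [LHS](reindex_inj k_inj) /= mulr_suml; apply: eq_bigr => j _.
  by rewrite !kE // [X in _ * X]rmorphM /= mulrACA.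
apply/eqP; move/eqP: E; rewrite -subr_eq0 -{1}[herm _ _ _]mulr1 -mulrBr.
rewrite mulf_eq0 => /orP[//|]; rewrite subr_eq0 => /eqP E.
case/eqP: igh; rewrite -[RHS]mul1r E -mulrA [_^* * _]mulrC -normCK.
by rewrite unit_norm1 // expr1n mulr1.
Qed.

Lemma comp_orth_proj g : g \in t -> orth_proj s (p g).
Proof.
move=> gt; split; first exact: (comp_add pG).
move=> x; rewrite -{1}(subrK (p g x) x) [RHS]addrC; apply: sqnD.
rewrite {1}(comp_sum pG x) (big_rem g) //= addrC addrK.
have ut : uniq t by case: tG.
apply: herm_suml => h; rewrite mem_rem_uniq // inE => /andP[hg ht].
have [a ->] := comp_mem pG h x; have [b ->] := comp_mem pG g x.
exact: comp_herm0.
Qed.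

End GradingTheory.

(** * Gradings with a homogeneous unit in every degree *)

Section GroupElements.

Variables (R : comPzRingType) (t : seq R) (tG : finite_group t).

(* The proof [tG] is made a parameter of the type, for the zmodType instance of
   the elements of [t] to be inferable from the type alone. *)
Definition group_pred of finite_group t : seq R := t.

Record group_elt := GroupElt {
  elt_val : R;
  elt_valP : elt_val \in group_pred tG
}.

HB.instance Definition _ := [isSub for elt_val].
HB.instance Definition _ := [Choice of group_elt by <:].

Definition inv_in (x : R) : R := head 1 [seq y <- t | x * y == 1].

Lemma inv_inP x : x \in t -> inv_in x \in t /\ x * inv_in x = 1.
Proof.
case: tG => _ _ _ tV xt; have [y yt xy] := tV x xt.
have : y \in [seq y <- t | x * y == 1] by rewrite mem_filter xy eqxx.
rewrite /inv_in; case E : [seq y <- t | x * y == 1] => [//|z r] _ /=.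
have : z \in [seq y <- t | x * y == 1] by rewrite E mem_head.
by rewrite mem_filter => /andP[/eqP].
Qed.

Lemma elt_mul_subproof (x y : group_elt) : val x * val y \in t.
Proof. by have [_ _ tM _] := tG; rewrite tM ?elt_valP. Qed.

Lemma elt_one_subproof : (1 : R) \in t.
Proof. by case: tG. Qed.

Lemma elt_inv_subproof (x : group_elt) : inv_in (val x) \in t.
Proof. by have [] := inv_inP (elt_valP x). Qed.

Definition elt_mul x y := GroupElt (elt_mul_subproof x y).
Definition elt_one := GroupElt elt_one_subproof.
Definition elt_inv x := GroupElt (elt_inv_subproof x).

Lemma elt_mulA : associative elt_mul.
Proof. by move=> x y z; apply: val_inj; apply: mulrA. Qed.

Lemma elt_mulC : commutative elt_mul.
Proof. by move=> x y; apply: val_inj; apply: mulrC. Qed.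

Lemma elt_mul1 : left_id elt_one elt_mul.
Proof. by move=> x; apply: val_inj; apply: mul1r. Qed.

Lemma elt_mulV : left_inverse elt_one elt_inv elt_mul.
Proof.
move=> x; apply: val_inj; rewrite /= mulrC.
by have [] := inv_inP (elt_valP x).
Qed.

HB.instance Definition _ :=
  GRing.isZmodule.Build group_elt elt_mulA elt_mulC elt_mul1 elt_mulV.

Lemma elt_seq : exists2 r : seq group_elt, uniq r & r =i predT.
Proof.
exists (pmap insub t); first by apply: pmap_sub_uniq; case: tG.
by move=> x; rewrite mem_pmap_sub elt_valP.
Qed.

End GroupElements.

Section Subring.

Variables (A : comPzRingType) (P : {pred A}) (P_subring : subring_closed P).

(** As with [group_pred], the closure proof is carried by the type so that the ring instance can be
    inferred. *)
Definition subring_pred of subring_closed P := P.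

HB.instance Definition _ :=
  GRing.isSubringClosed.Build A (subring_pred P_subring) P_subring.

Record subring := Subring {
  subring_val : A;
  subring_valP : subring_val \in subring_pred P_subring
}.

HB.instance Definition _ := [isSub for subring_val].
HB.instance Definition _ := [Choice of subring by <:].
HB.instance Definition _ :=
  GRing.SubChoice_isSubComPzRing.Build A _ subring
    (GRing.subringClosedP (subring_pred P_subring)).

End Subring.

Section GradedRing.

Variables (A R : comPzRingType) (t : seq R) (tG : finite_group t).
Variables (c : R -> A -> A) (v : R -> A).
Hypothesis c_add : forall k, {morph c k : x y / x + y}.
Hypothesis c_sum : forall x, x = \sum_(k <- t) c k x.
Hypothesis c_orth : {in t &, forall k l x, c k (c l x) = if k == l then c l x else 0}.
Hypothesis c_mul : {in t &, forall k l x y,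
  c k x = x -> c l y = y -> c (k * l) (x * y) = x * y}.
Hypothesis v_hom : {in t, forall k, c k (v k) = v k}.
Hypothesis v_mul : {in t &, {morph v : k l / k * l}}.
Hypothesis v1 : v 1 = 1.

Lemma degree1_subring : subring_closed [pred x | c 1 x == x].
Proof.
have [_ t1 _ _] := tG.
split=> [|x y|x y]; rewrite !inE.
- by rewrite -v1 v_hom.
- move=> /eqP x1 /eqP y1; apply/eqP; apply: (addIr y).
  by rewrite -{2}y1 -c_add !subrK.
by move=> /eqP x1 /eqP y1; rewrite -{1}[1]mulr1 c_mul.
Qed.

(** The part of degree 1 is a subring, and multiplication by the unit [v k] identifies it with the
    part of degree [k]. Since [v] is multiplicative, these units form a group basis. *)
Lemma graded_iso_group_ring :
  exists A' : comPzRingType, iso_group_ring A A' (group_elt tG).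
Proof.
have [_ t1 tM _] := tG.
exists (subring degree1_subring : comPzRingType).
exists (val : {rmorphism subring degree1_subring -> A}).
exists (fun k => v (val k)); split=> //.
  by move=> k l; rewrite -v_mul ?elt_valP.
have [r ur rT] := elt_seq tG.
have sum_r (F : R -> A) : \sum_(k <- r) F (val k) = \sum_(k <- t) F k.
  rewrite -[LHS](big_map val predT F); apply: perm_big; apply: uniq_perm.
  - by rewrite map_inj_uniq //; apply: val_inj.
  - by case: tG.
  move=> k; apply/mapP/idP => [[l _ ->]|kt]; first exact: elt_valP.
  by exists (@GroupElt _ _ tG k kt); rewrite ?rT.
have unit_v k : k \in t -> v k * v (inv_in t k) = 1.
  by move=> kt; have [? E] := inv_inP tG kt; rewrite -v_mul // E v1.
apply/(gr_bijP _ _ ur rT); split.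
  move=> x.
  have deg1 (k : group_elt tG) :
      c (val k) x * v (inv_in t (val k)) \in subring_pred degree1_subring.
    have kt := elt_valP k; have [it E] := inv_inP tG kt.
    by rewrite !inE -{1}E c_mul ?v_hom // c_orth // eqxx.
  exists (fun k => Subring (deg1 k)).
  rewrite [LHS]c_sum -sum_r; apply: eq_bigr => k _ /=.
  by rewrite -mulrA [v _ * v (val k)]mulrC unit_v ?mulr1 ?elt_valP.
move=> a b ab l _; apply: val_inj.
have c0 k : c k 0 = 0 by apply: (addIr (c k 0)); rewrite -c_add !add0r.
have cl (d : group_elt tG -> subring degree1_subring) :
    c (val l) (\sum_(k <- r) val (d k) * v (val k)) = val (d l) * v (val l).
  have cd k : c (val k) (val (d k) * v (val k)) = val (d k) * v (val k).
    have := valP (d k); rewrite !inE => /eqP d1.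
    by rewrite -{1}[val k]mul1r c_mul ?v_hom ?elt_valP.
  rewrite (big_morph _ (c_add _) (c0 _)) (big_rem l) ?rT //= cd.
  rewrite big_seq big1 ?addr0 // => k; rewrite mem_rem_uniq // inE => /andP[kl _].
  by rewrite -cd c_orth ?elt_valP // eq_sym (inj_eq val_inj) (negPf kl).
have := congr1 (c (val l)) ab; rewrite !cl => E.
by rewrite -[LHS]mulr1 -[RHS]mulr1 -(unit_v (val l)) ?elt_valP // !mulrA E.
Qed.

End GradedRing.

(** * Two commuting gradings *)

Lemma big_seq_if_eq (V : nmodType) (I : eqType) (u : seq I) (P : pred I)
    (F : I -> V) h :
  uniq u -> h \in u ->
  \sum_(i <- u | P i) (if i == h then F i else 0) = if P h then F h else 0.
Proof.
move=> uu hu; rewrite big_mkcond (big_rem h) //= eqxx.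
rewrite big_seq big1 ?addr0 // => i.
by rewrite mem_rem_uniq // inE => /andP[/negPf -> _]; rewrite if_same.
Qed.

Lemma choice_in (T : eqType) (U : Type) (r : seq T) (P : T -> U -> Prop) :
  U -> (forall x, x \in r -> exists y, P x y) ->
  exists f : T -> U, forall x, x \in r -> P x (f x).
Proof.
move=> y0 ex; have /choice[f fP] : forall x, exists y, x \in r -> P x y.
  move=> x; have [/ex[y xy]|_] := boolP (x \in r); first by exists y.
  by exists y0.
by exists f.
Qed.

Section GroupMorphism.

Variables (R S : comPzRingType) (t : seq R) (u : seq S) (f : R -> S).
Hypotheses (tG : finite_group t) (uG : finite_group u).
Hypothesis ft : {in t, forall x, f x \in u}.
Hypothesis fM : {in t &, {morph f : x y / x * y}}.

Lemma finite_group_morph1 : f 1 = 1.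
Proof.
have [_ t1 _ _] := tG; have [_ _ _ uV] := uG.
have [y _ fy] := uV _ (ft t1).
by rewrite -[LHS]mulr1 -{1}fy mulrA -fM // mulr1.
Qed.

End GroupMorphism.

Section FixedSubgroup.

Variables (R : comPzRingType) (u : seq R) (f : R -> R).
Hypotheses (uG : finite_group u).
Hypothesis fu : {in u, forall x, f x \in u}.
Hypothesis fM : {in u &, {morph f : x y / x * y}}.

Lemma iter_mem k : {in u, forall x, iter k f x \in u}.
Proof. by elim: k => //= k IH x xu; rewrite fu ?IH. Qed.

Lemma iter_morph k : {in u &, {morph iter k f : x y / x * y}}.
Proof. by elim: k => //= k IH x y xu yu; rewrite IH // fM ?iter_mem. Qed.

Lemma fixed_subgroup : finite_group [seq x <- u | f x == x].
Proof.
have [uu u1 uM uV] := uG.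
split; first exact: filter_uniq.
- by rewrite mem_filter u1 (finite_group_morph1 uG uG) ?eqxx.
- move=> x y; rewrite !mem_filter => /andP[/eqP fx xu] /andP[/eqP fy yu].
  by rewrite fM // fx fy eqxx uM.
move=> x; rewrite mem_filter => /andP[/eqP fx xu]; have [y yu xy] := uV x xu.
exists y => //; rewrite mem_filter yu andbT; apply/eqP.
rewrite -[RHS]mulr1 -(finite_group_morph1 uG uG fu fM) -xy fM // fx mulrA.
by rewrite [y * x]mulrC xy mul1r.
Qed.

End FixedSubgroup.

Definition homog (R A : comPzRingType) (iA : A -> R) (t : seq R) (x g : R) :=
  g \in t /\ exists a, x = iA a * g.

Section Homogeneous.

Variables (R A : comPzRingType) (iA : {rmorphism A -> R}) (t : seq R).
Variable p : R -> R -> R.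
Hypotheses (R01 : (0 : R) != 1) (tG : finite_group t).
Hypothesis pG : group_grading iA t p.

Lemma finite_group_neq0 g : g \in t -> g != 0.
Proof.
case: tG => _ _ _ tV gt; have [h _ gh] := tV g gt.
by apply: contraNneq R01 => g0; rewrite -gh g0 mul0r.
Qed.

Lemma homog_comp x g h : homog iA t x g -> p h x = if h == g then x else 0.
Proof. by case=> gt [a ->]; rewrite (comp_hom pG). Qed.

Lemma homog_uniq x g h : x != 0 -> homog iA t x g -> homog iA t x h -> g = h.
Proof.
move=> x0 xg xh; apply/eqP; apply: contraNT x0 => gh.
by have := homog_comp h xg; rewrite (homog_comp h xh) eqxx eq_sym (negPf gh) => ->.
Qed.

Lemma homog_refl g : g \in t -> homog iA t g g.
Proof. by move=> gt; split=> //; exists 1; rewrite rmorph1 mul1r. Qed.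

Lemma homogM x y g h :
  homog iA t x g -> homog iA t y h -> homog iA t (x * y) (g * h).
Proof.
case: tG => _ _ tM _ [gt [a ->]] [ht [b ->]]; split; first exact: tM.
by exists (a * b); rewrite rmorphM mulrACA.
Qed.

Lemma homogX x g k : homog iA t x g -> homog iA t (x ^+ k) (g ^+ k).
Proof.
move=> xg; elim: k => [|k IH]; last by rewrite !exprS; apply: homogM.
by rewrite !expr0; apply: homog_refl; case: tG.
Qed.

Lemma homog_compP g x : g \in t -> homog iA t (p g x) g.
Proof. by move=> gt; split=> //; apply: comp_mem pG _ _. Qed.

End Homogeneous.

(** * Degree maps between the two groups, their kernels, and the exchange of group bases *)

Section BigradedRing.

Variables (R A B : comPzRingType) (iA : {rmorphism A -> R}).
Variables (iB : {rmorphism B -> R}) (t u : seq R) (pA pB : R -> R -> R).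
Hypotheses (R01 : (0 : R) != 1) (iA_inj : injective iA).
Hypotheses (tG : finite_group t) (uG : finite_group u).
Hypotheses (pAG : group_grading iA t pA) (pBG : group_grading iB u pB).
Hypothesis pAB : forall g h x, g \in t -> h \in u ->
  pA g (pB h x) = pB h (pA g x).
Hypothesis degB : forall g, g \in t -> exists h, homog iB u g h.
Hypothesis degA : forall h, h \in u -> exists g, homog iA t h g.

(** Degrees multiply, and a nonzero element has only one degree. The grading is left generic so that
    both degree maps are covered. *)
Lemma degree_morphism (C : comPzRingType) (iC : {rmorphism C -> R})
    (v w : seq R) (q : R -> R -> R) (d : R -> R) :
  finite_group v -> finite_group w -> group_grading iC w q ->
  (forall x, x \in v -> homog iC w x (d x)) -> {in v &, {morph d : x y / x * y}}.
Proof.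
move=> vG wG qG dP x y xv yv; have [_ _ vM _] := vG.
apply: (homog_uniq qG (finite_group_neq0 R01 vG (vM _ _ xv yv))).
  by apply: dP; apply: vM.
by apply: (homogM wG); apply: dP.
Qed.

(* Write phi : G -> H and psi : H -> G for the degree maps.  For h in H, the unit
   s h = h / psi h lies in A and is homogeneous of B-degree
   tau h = h / phi (psi h).  A nontrivial h in A is fixed by tau, so that an
   idempotent power theta = tau^N has a nontrivial image K; grading A by K via
   theta, the elements s (tau^(N-1) k) are homogeneous units of degree k, whence
   A = A_1[K]. *)
Lemma stark_kernel h0 : stark A -> h0 \in u -> (exists a, h0 = iA a) -> h0 = 1.
Proof.
move=> A_stark h0u h0A; apply/eqP; apply: contraT => h01; case: A_stark.
have [uu u1 uM uV] := uG; have [ut t1 tM tV] := tG.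
have [e1 e1_gt0 te] := finite_group_expn tG.
have [e2 e2_gt0 ue] := finite_group_expn uG.
(* The exponent [e] is chosen so that [x ^+ e] is the inverse of [x] on both [t] and [u]. *)
pose e := (e1 * e2).-1.
have eS : e.+1 = (e1 * e2)%N by rewrite prednK // muln_gt0 e1_gt0.
have mulVt g : g \in t -> g * g ^+ e = 1.
  by move=> gt; rewrite -exprS eS exprM te // expr1n.
have [phi phiP] := choice_in 0 degB.
have [psi psiP] := choice_in 0 degA.
have phiM := degree_morphism tG uG pBG phiP.
have psiM := degree_morphism uG tG pAG psiP.
have phiu g : g \in t -> phi g \in u by case/phiP.
have psit h : h \in u -> psi h \in t by case/psiP.
pose s h := h * psi h ^+ e; pose tau h := h * phi (psi h) ^+ e.
have sA h : h \in u -> exists a, s h = iA a.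
  move=> hu; have [gt [a E]] := psiP h hu; exists a.
  by rewrite /s {1}E -mulrA mulVt // mulr1.
have sB h : h \in u -> homog iB u (s h) (tau h).
  move=> hu; apply: (homogM uG); first exact: homog_refl.
  by apply: (homogX uG); apply: phiP; apply: psit.
have sM : {in u &, {morph s : x y / x * y}}.
  by move=> x y xu yu; rewrite /s psiM // exprMn mulrACA.
have tauu h : h \in u -> tau h \in u by case/sB.
have tauM : {in u &, {morph tau : x y / x * y}}.
  by move=> x y xu yu; rewrite /tau psiM // phiM ?psit // exprMn mulrACA.
have [N N_gt0 tauN] := iter_idempotent tauu.
pose theta := iter N tau.
have thu := iter_mem tauu N : {in u, forall x, theta x \in u}.
have thM := iter_morph tauu tauM N : {in u &, {morph theta : x y / x * y}}.
have KG := fixed_subgroup uG thu thM; set K := [seq k <- u | theta k == k] in KG.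
have Ku k : k \in K -> k \in u by rewrite mem_filter => /andP[].
have Kth k : k \in K -> theta k = k by rewrite mem_filter => /andP[/eqP].
have thK h : h \in u -> theta h \in K.
  by move=> hu; rewrite mem_filter thu // /theta tauN ?eqxx.
(* The projections [pB h] preserve [A], because they commute with [pA 1], the projection onto [A];
   [q h] is the restriction. *)
have [q qE] : exists q : R -> A -> A,
    forall h, h \in u -> forall a, iA (q h a) = pB h (iA a).
  apply: (@choice_in _ _ _ (fun h f => forall a, iA (f a) = pB h (iA a)) (fun=> 0)).
  move=> h hu.
  have /choice[f fE] : forall a, exists b, iA b = pB h (iA a); last by exists f.
  move=> a; have <- : pA 1 (pB h (iA a)) = pB h (iA a).
    by rewrite pAB // -[iA a]mulr1 (comp_hom pAG) // eqxx.
  by have [b ->] := comp_mem pAG 1 (pB h (iA a)); exists b; rewrite mulr1.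
have qD h : h \in u -> {morph q h : x y / x + y}.
  by move=> hu x y; apply: iA_inj; rewrite rmorphD !qE // rmorphD (comp_add pBG).
(* The grading of [A] by [u] is coarsened along [theta]: degree [k] collects the whole fibre over
   [k]. *)
pose c k a := \sum_(h <- u | theta h == k) q h a.
have c_add k : {morph c k : x y / x + y}.
  move=> x y; rewrite /c -big_split big_seq_cond [RHS]big_seq_cond.
  by apply: eq_bigr => h /andP[hu _]; rewrite qD.
have q_homog a h l : homog iB u (iA a) h -> l \in u -> q l a = if l == h then a else 0.
  move=> ah lu; apply: iA_inj; rewrite qE // (homog_comp pBG l ah).
  by case: ifP; rewrite ?rmorph0.
have c_homog a h k : homog iB u (iA a) h -> c k a = if theta h == k then a else 0.
  move=> ah; have hu : h \in u by case: ah.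
  rewrite /c -(@big_seq_if_eq _ _ u (fun l => theta l == k) (fun=> a)) //.
  rewrite big_seq_cond [RHS]big_seq_cond; apply: eq_bigr => l /andP[lu _].
  exact: q_homog.
have qP h a : h \in u -> homog iB u (iA (q h a)) h.
  by move=> hu; rewrite qE //; apply: homog_compP.
have c0 k : c k 0 = 0 by apply: (addIr (c k 0)); rewrite -c_add !add0r.
have c_fix k a : c k a = a -> a = \sum_(h <- u | theta h == k) q h a.
  by move=> E; rewrite -[LHS]E.
have c_sum x : x = \sum_(k <- K) c k x.
  rewrite /c (exchange_big_dep predT) //=.
  transitivity (\sum_(h <- u) q h x).
    apply: iA_inj; rewrite rmorph_sum [LHS](comp_sum pBG).
    by apply: eq_big_seq => h hu; rewrite qE.
  apply: eq_big_seq => h hu; under eq_bigl => k do rewrite eq_sym.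
  rewrite big_mkcond (@big_seq_if_eq _ _ K predT (fun=> q h x)) ?thK //.
  by rewrite filter_uniq.
have c_orth : {in K &, forall k l x, c k (c l x) = if k == l then c l x else 0}.
  move=> k l kK lK x.
  rewrite {2}/c (big_morph _ (c_add k) (c0 k)) big_seq_cond.
  under eq_bigr => h /andP[hu /eqP hl] do
    rewrite (c_homog _ _ k (qP h x hu)) hl eq_sym.
  rewrite -big_seq_cond; case: ifP => // _.
  by rewrite big1.
have c_mul : {in K &, forall k l x y,
    c k x = x -> c l y = y -> c (k * l) (x * y) = x * y}.
  move=> k l kK lK x y /c_fix xE /c_fix yE; rewrite xE yE mulr_suml.
  rewrite (big_morph _ (c_add _) (c0 _)) big_seq_cond [RHS]big_seq_cond.
  apply: eq_bigr => h /andP[hu /eqP hk].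
  rewrite mulr_sumr (big_morph _ (c_add _) (c0 _)) big_seq_cond [RHS]big_seq_cond.
  apply: eq_bigr => h' /andP[hu' /eqP hl].
  rewrite (@c_homog _ (h * h')) ?thM ?hk ?hl ?eqxx // rmorphM.
  by apply: (homogM uG); apply: qP.
pose w k := s (iter N.-1 tau k).
have wu := iter_mem tauu N.-1.
have wM := iter_morph tauu tauM N.-1.
have [v vE] : exists v : R -> A, forall k, k \in K -> iA (v k) = w k.
  apply: (@choice_in _ _ _ (fun k a => iA a = w k) 0) => k /Ku ku.
  by have [a aE] := sA _ (wu k ku); exists a.
have [_ K1 KM _] := KG.
have v_mul : {in K &, {morph v : k l / k * l}}.
  move=> k l kK lK; apply: iA_inj.
  by rewrite rmorphM !vE ?KM // /w wM ?Ku // sM ?wu ?Ku.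
have v1 : v 1 = 1.
  apply: iA_inj; rewrite vE // /w (finite_group_morph1 uG uG wu wM).
  by rewrite /s (finite_group_morph1 uG tG psit psiM) expr1n mulr1 rmorph1.
have v_hom : {in K, forall k, c k (v k) = v k}.
  move=> k kK; rewrite (@c_homog _ k) ?Kth ?eqxx // vE //.
  rewrite -{2}(Kth k kK) /theta -(prednK N_gt0) iterS.
  by apply: sB; apply: wu; apply: Ku.
have [A' A'K] := graded_iso_group_ring KG c_add c_sum c_orth c_mul v_hom v_mul v1.
exists A', (group_elt KG); split=> //.
have tau_h0 : tau h0 = h0.
  have [a aE] := h0A; rewrite /tau.
  have -> : psi h0 = 1.
    apply: (homog_uniq pAG (finite_group_neq0 R01 uG h0u)); first exact: psiP.
    by split=> //; exists a; rewrite mulr1.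
  by rewrite (finite_group_morph1 tG uG phiu phiM) expr1n mulr1.
have h0K : h0 \in K.
  by rewrite mem_filter h0u andbT /theta; apply/eqP/iter_fix.
by exists (@GroupElt _ _ KG h0 h0K); apply: contra h01 => /eqP/(congr1 val)/= ->.
Qed.

(** The quotient of [h] by [h'] has degree 1, so it lies in [A], and [stark_kernel] makes it
    trivial. *)
Lemma degree_inj h h' g : stark A -> h \in u -> h' \in u ->
  homog iA t h g -> homog iA t h' g -> h = h'.
Proof.
move=> A_stark hu h'u hg h'g; have [_ _ uM uV] := uG.
have [y yu h'y] := uV _ h'u; have [g' yg'] := degA yu.
have gg' : g * g' = 1.
  apply: (homog_uniq pAG (_ : 1 != 0)); first by rewrite eq_sym.
    by rewrite -h'y; apply: (homogM tG).
  by apply: homog_refl; case: tG.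
suff hy : h * y = 1 by rewrite -[LHS]mulr1 -h'y mulrCA hy mulr1.
apply: stark_kernel => //; first exact: uM.
have [_ [a ->]] := homogM tG hg yg'.
by exists a; rewrite gg' mulr1.
Qed.

Lemma degree_map : stark A ->
  exists d : R -> R,
    [/\ forall h, h \in u -> homog iA t h (d h), uniq (map d u)
      & {subset map d u <= t}].
Proof.
move=> A_stark; have [d dP] := choice_in 0 degA.
exists d; split=> // [|_ /mapP[h hu ->]]; last by case: (dP h hu).
rewrite map_inj_in_uniq; first by case: uG.
move=> h h' hu h'u E; apply: (degree_inj A_stark hu h'u (dP h hu)).
by rewrite E; apply: dP.
Qed.

Lemma leq_size_degree : stark A -> (size u <= size t)%N.
Proof.
move=> /degree_map[d [_ du dt]].
by rewrite -(size_map d); apply: uniq_leq_size.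
Qed.

(* Each h in H is a unit of A times its degree in G, and the degree map is
   bijective, so that (+) A g = (+) A h. *)
Lemma group_ring_transfer (H : {pred R}) :
  stark A -> (size t <= size u)%N -> u =i H -> group_ring_eq iA H.
Proof.
move=> A_stark tu uH; have [d [dP du dt]] := degree_map A_stark.
have [uu u1 uM uV] := uG; have [ut t1 _ _] := tG.
have perm_t : perm_eq t (map d u).
  apply: uniq_perm => // g; have := uniq_min_size du dt.
  by rewrite size_map => /(_ tu)[_ ->].
have [a aE] : exists a : R -> A, forall h, h \in u -> h = iA (a h) * d h.
  by apply: (@choice_in _ _ _ (fun h a => h = iA a * d h) 0) => h /dP[].
have [b bE] : exists b : R -> A, forall h, h \in u -> a h * b h = 1.
  apply: (@choice_in _ _ _ (fun h b => a h * b = 1) 0) => h hu.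
  (* The inverse of [a h] comes from the inverse [y] of [h]: [d h * d y] is the degree of
     [h * y = 1], hence 1. *)
  have [y yu hy] := uV _ hu; exists (a y); apply: iA_inj; rewrite rmorphM rmorph1.
  have dd : d h * d y = 1.
    apply: (homog_uniq pAG (_ : 1 != 0)); first by rewrite eq_sym.
      by rewrite -hy; apply: (homogM tG); apply: dP.
    exact: homog_refl.
  by rewrite -[LHS]mulr1 -{1}dd mulrACA -!aE.
apply/(gr_bijP _ _ uu uH); split.
  move=> x.
  have [F FE] := choice (comp_mem pAG ^~ x).
  (* Since [h = iA (a h) * d h], multiplying [h] by the image of [b h] recovers [d h]. *)
  exists (fun h => F (d h) * b h).
  rewrite {1}(comp_sum pAG x) (perm_big _ perm_t) big_map.
  apply: eq_big_seq => h hu; rewrite FE [X in _ = _ * X](aE h hu) [RHS]mulrA -rmorphM.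
  by rewrite -mulrA [b h * _]mulrC bE // mulr1.
move=> k l kl h hu; apply: iA_inj.
(* Distinct elements of [u] have distinct degrees, so the component of degree [d h] sees only the
   term at [h]. *)
have pd (m : R -> A) : pA (d h) (\sum_(i <- u) iA (m i) * i) = iA (m h) * h.
  rewrite (comp_big pAG) (bigD1_seq h) //= big_seq_cond big1 ?addr0.
    rewrite [X in pA _ (_ * X)](aE h hu) mulrA -rmorphM (comp_hom pAG) ?eqxx.
      by rewrite rmorphM -mulrA -aE.
    by case: (dP h hu).
  move=> i /andP[iu ih].
  rewrite [X in pA _ (_ * X)](aE i iu) mulrA -rmorphM (comp_hom pAG);
    last by case: (dP i iu).
  case: eqP => // E; case/eqP: ih; apply: (degree_inj A_stark iu hu (dP i iu)).
  by rewrite -E; apply: dP.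
have [y _ hy] := uV h hu.
have := congr1 (pA (d h)) kl; rewrite !pd => /(congr1 (fun x => x * y)).
by rewrite -!mulrA hy !mulr1.
Qed.

End BigradedRing.

(** * Homogeneity of the group elements and the two exchanged decompositions *)

Lemma units_finite_group (R : comPzRingType) (G : {pred R}) (t : seq R) :
  uniq t -> t =i G -> subgroup_of_units G -> finite_group t.
Proof.
move=> ut tG [G1 GM GV]; split=> // [|x y|x]; rewrite ?tG //; first exact: GM.
by move=> /GV[y yG xy]; exists y; rewrite ?tG.
Qed.

Lemma unit_homogeneous (R B : comPzRingType) (iB : {rmorphism B -> R})
    (u : seq R) (p : R -> R -> R) g :
  (0 : R) != 1 -> finite_group u -> group_grading iB u p -> g != 0 ->
  (forall h, h \in u -> p h g = 0 \/ p h g = g) -> exists h, homog iB u g h.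
Proof.
move=> R01 uG pG g0 gp.
have [/hasP[h hu /eqP ph]|] := boolP (has (fun h => p h g == g) u).
  by exists h; rewrite -{1}ph; apply: (homog_compP pG).
move=> /hasPn np; case/eqP: g0; rewrite (comp_sum pG g) big_seq big1 // => h hu.
by case: (gp h hu) => // /eqP; rewrite (negPf (np h hu)).
Qed.

Theorem theorem1p3 (R : comPzRingType)
  (A B : comPzRingType) (iA : {rmorphism A -> R}) (iB : {rmorphism B -> R})
  (G H : {pred R}) :
  is_order R -> reduced R -> connected R ->
  injective iA -> injective iB -> stark A -> stark B ->
  subgroup_of_units G -> subgroup_of_units H ->
  group_ring_eq iA G -> group_ring_eq iB H ->
  group_ring_eq iA H /\ group_ring_eq iB G.
Proof.
move=> R_order R_red R_conn iA_inj iB_inj A_stark B_stark Gu Hu AG BH.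
have R01 : (0 : R) != 1 by case: R_conn.
have [t ut tG] := group_ring_finite R_order R01 AG.
have [u uu uH] := group_ring_finite R_order R01 BH.
have t_grp := units_finite_group ut tG Gu.
have u_grp := units_finite_group uu uH Hu.
have [pA pAG] := group_ring_grading ut tG AG.
have [pB pBG] := group_ring_grading uu uH BH.
have [n [s [s_uniq s_compl s_inj [eps eps0 eps_small] nm]]] :=
  order_embeddings R_order R_red R01.
have orthA g : g \in t -> orth_proj s (pA g).
  exact: (comp_orth_proj t_grp pAG s_uniq s_compl s_inj).
have orthB h : h \in u -> orth_proj s (pB h).
  exact: (comp_orth_proj u_grp pBG s_uniq s_compl s_inj).
have pAB g h x : g \in t -> h \in u -> pA g (pB h x) = pB h (pA g x).
  by move=> /orthA oA /orthB oB; apply: (orth_proj_comm eps0 eps_small oA oB).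
have unitary v w x p : finite_group v -> x \in v -> x * w = 1 ->
    orth_proj s p -> p x = 0 \/ p x = x.
  move=> v_grp xv xw op.
  apply: (orth_proj_unitary eps0 eps_small nm R_red R_conn op xw) => j.
  exact: (unit_norm1 v_grp).
have degB g : g \in t -> exists h, homog iB u g h.
  move=> gt; have [_ _ _ tV] := t_grp; have [w _ gw] := tV g gt.
  apply: (unit_homogeneous R01 u_grp pBG); first exact: (finite_group_neq0 R01 t_grp).
  by move=> h /orthB; apply: unitary gt gw.
have degA h : h \in u -> exists g, homog iA t h g.
  move=> hu; have [_ _ _ uV] := u_grp; have [w _ hw] := uV h hu.
  apply: (unit_homogeneous R01 t_grp pAG); first exact: (finite_group_neq0 R01 u_grp).
  by move=> g /orthA; apply: unitary hu hw.
have pBA h g x : h \in u -> g \in t -> pB h (pA g x) = pA g (pB h x).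
  by move=> hu gt; rewrite pAB.
(* Starkness of [A] bounds the order of [H] by that of [G], and starkness of [B] gives the converse;
   equal orders turn the injective degree maps into bijections. *)
have ut_le := leq_size_degree R01 iA_inj t_grp u_grp pAG pBG pAB degB degA A_stark.
have tu_le := leq_size_degree R01 iB_inj u_grp t_grp pBG pAG pBA degA degB B_stark.
split.
  exact: (group_ring_transfer R01 iA_inj t_grp u_grp pAG pBG pAB degB degA).
exact: (group_ring_transfer R01 iB_inj u_grp t_grp pBG pAG pBA degA degB).
Qed.
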